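(* In the boundary-driven switching system with $\epsilon=0$, $\gamma>0$, $N\ge2$, writing $D=1+N+2N\gamma$, for all $x\in V$ $$\theta_0(x)=\tfrac{1+\gamma}{1+2\gamma}\Big[\Big(\tfrac{(1+N)+(1+2N)\gamma}{D}-\tfrac{1+2\gamma}{D}x\Big)\rho_{L,0}+\Big(\tfrac{-\gamma}{D}+\tfrac{1+2\gamma}{D}x\Big)\rho_{R,0}\Big]+\tfrac{\gamma}{1+2\gamma}\Big[\Big(\tfrac{(1+N)+(1+2N)\gamma}{D}-\tfrac{1+2\gamma}{D}x\Big)\rho_{L,1}+\Big(\tfrac{-\gamma}{D}+\tfrac{1+2\gamma}{D}x\Big)\rho_{R,1}\Big],$$ and $$\theta_1(1)=\tfrac{\gamma}{1+\gamma}\theta_0(1)+\tfrac1{1+\gamma}\rho_{L,1},\qquad \theta_1(x)=\theta_0(x)\ (x\in\{2,\dots,N-1\}),\qquad \theta_1(N)=\tfrac{\gamma}{1+\gamma}\theta_0(N)+\tfrac1{1+\gamma}\rho_{R,1}.$$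
   Context: Boundary-driven switching system: fix $\sigma\in\{-1,0,1\}$, $N\in\mathbb N$, $V=\{1,\dots,N\}$, $\epsilon\in[0,1]$, $\gamma>0$, and reservoir parameters $\rho_{L,0},\rho_{L,1},\rho_{R,0},\rho_{R,1}\ge0$ (in $[0,1]$ if $\sigma=-1$). Configurations are $\eta=(\eta_0(x),\eta_1(x))_{x\in V}$ with values in $\{0,1\}$ if $\sigma=-1$ and in $\mathbb N_0$ if $\sigma\in\{0,1\}$. Writing $\delta_{(x,i)}$ for one particle at site $x$ in layer $i$, the continuous-time Markov chain has transitions: for $x\in\{1,\dots,N-1\}$, $i\in\{0,1\}$, $\eta\to\eta-\delta_{(x,i)}+\delta_{(x+1,i)}$ at rate $\epsilon^i\eta_i(x)(1+\sigma\eta_i(x+1))$ and $\eta\to\eta-\delta_{(x+1,i)}+\delta_{(x,i)}$ at rate $\epsilon^i\eta_i(x+1)(1+\sigma\eta_i(x))$ ($\epsilon^0=1$); for $x\in V$, $\eta\to\eta-\delta_{(x,i)}+\delta_{(x,1-i)}$ at rate $\gamma\eta_i(x)(1+\sigma\eta_{1-i}(x))$; and for $i\in\{0,1\}$, $\eta\to\eta-\delta_{(1,i)}$ at rate $\eta_i(1)(1+\sigma\rho_{L,i})$, $\eta\to\eta+\delta_{(1,i)}$ at rate $\rho_{L,i}(1+\sigma\eta_i(1))$, $\eta\to\eta-\delta_{(N,i)}$ at rate $\eta_i(N)(1+\sigma\rho_{R,i})$, $\eta\to\eta+\delta_{(N,i)}$ at rate $\rho_{R,i}(1+\sigma\eta_i(N))$.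 This chain has a unique stationary distribution $\mu_{stat}$, and $\theta_i(x):=\mathbb E_{\mu_{stat}}[\eta_i(x)]$ is the stationary microscopic profile. *)

(* Defs.v *)
From mathcomp Require Import all_boot all_order all_algebra.
From mathcomp Require Import all_classical all_reals all_analysis.
Import Order.TTheory GRing.Theory Num.Theory.
Set Implicit Arguments.
Unset Strict Implicit.
Unset Printing Implicit Defensive.
Local Open Scope ring_scope.

(* A configuration: eta (i, x) = number of particles in layer i at site x+1
   (sites V = {1..N} are encoded by x : 'I_N, site = x + 1). *)
Definition config (N : nat) := {ffun 'I_2 * 'I_N -> nat}.

Definition cupd N (e : config N) (k : 'I_2 * 'I_N) (f : nat -> nat) : config N :=
  [ffun j => if j == k then f (e j) else e j].

Definition cmove N (e : config N) (a b : 'I_2 * 'I_N) : config N :=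
  cupd (cupd e a predn) b succn.
Definition cadd N (e : config N) (a : 'I_2 * 'I_N) : config N := cupd e a succn.
Definition cdel N (e : config N) (a : 'I_2 * 'I_N) : config N := cupd e a predn.

Definition layer0 : 'I_2 := @Ordinal 2 0 isT.
Definition layer1 : 'I_2 := @Ordinal 2 1 isT.
Definition flip (i : 'I_2) : 'I_2 := if i == layer0 then layer1 else layer0.

Definition transitions (R : realType) (N : nat) (sigma eps gamma : R)
    (rhoL rhoR : 'I_2 -> R) (e : config N) : seq (R * config N) :=
  let n (k : 'I_2 * 'I_N) := ((e k)%:R : R) in
  flatten [seq flatten [seq
    (if (x.+1 < N)%N then
       let y : 'I_N := insubd x x.+1 in
       [:: (eps ^+ i * n (i, x) * (1 + sigma * n (i, y)), cmove e (i, x) (i, y));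
           (eps ^+ i * n (i, y) * (1 + sigma * n (i, x)), cmove e (i, y) (i, x))]
     else [::])
    ++ [:: (gamma * n (i, x) * (1 + sigma * n (flip i, x)), cmove e (i, x) (flip i, x))]
    ++ (if val x == 0%N then
          [:: (n (i, x) * (1 + sigma * rhoL i), cdel e (i, x));
              (rhoL i * (1 + sigma * n (i, x)), cadd e (i, x))]
        else [::])
    ++ (if val x == N.-1 then
          [:: (n (i, x) * (1 + sigma * rhoR i), cdel e (i, x));
              (rhoR i * (1 + sigma * n (i, x)), cadd e (i, x))]
        else [::])
  | x : 'I_N <- enum 'I_N] | i : 'I_2 <- enum 'I_2].

Definition Qrate (R : realType) N sigma eps gamma rhoL rhoR (e e' : config N) : R :=
  \sum_(t <- @transitions R N sigma eps gamma rhoL rhoR e | t.2 == e') t.1.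

Definition outrate (R : realType) N sigma eps gamma rhoL rhoR (e : config N) : R :=
  \sum_(t <- @transitions R N sigma eps gamma rhoL rhoR e | t.2 != e) t.1.

Definition allowed (R : realType) N (sigma : R) (e : config N) : Prop :=
  sigma = -1 -> forall k, (e k <= 1)%N.

Definition is_stationary (R : realType) N (sigma eps gamma : R) (rhoL rhoR : 'I_2 -> R)
    (mu : config N -> R) : Prop :=
  [/\ forall e, 0 <= mu e,
      forall e, ~ allowed sigma e -> mu e = 0,
      (\esum_(e in [set: config N]) (mu e)%:E = 1)%E &
      forall e', allowed sigma e' ->
        ((mu e' * outrate sigma eps gamma rhoL rhoR e')%:E =
         \esum_(e in [set e | allowed sigma e /\ e != e'])
            (mu e * Qrate sigma eps gamma rhoL rhoR e e')%:E)%E].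

Definition theta (R : realType) N (mu : config N -> R) (i : 'I_2) (x : 'I_N) : \bar R :=
  (\esum_(e in [set: config N]) (mu e * (e (i, x))%:R)%:E)%E.

(* Main.v *)
(* Let [S g] denote the stationary expectation of [g >= 0].  Summing global balance against a
   nonnegative [phi] and exchanging the sums gives the weak balance [S (phi * out) = S (P phi)]
   in [0, +oo].  It is applied to [phi = ((n - f)^+)^2], where [f = 1 + sum_k w k * eta k] is a
   positive linear observable: [phi * out] is then bounded, so both sides are finite, and
   convexity compares the increments of [phi] with [-2 (n - f)^+] times the generator of [f].

   For a weight [w] with a uniform negative drift this bounds the mean number of particles.
   Once that mean is finite, the quadratic error of the linearisation, which is supported on
   [f < n + J], is at most [|eta| * min(n, |eta|)], which is [o(n)] in expectation although
   the rates grow quadratically when [sigma = 1].  Hence the expected generator of every linear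
   observable vanishes, the duality cancels [sigma], and the resulting linear equations for
   the profile are solved by hand. *)
Require Import Defs.
From mathcomp Require Import all_boot all_order all_algebra.
From mathcomp Require Import all_classical all_reals all_analysis.
From mathcomp Require Import finmap ring lra.
Import Order.TTheory GRing.Theory Num.Theory.
Local Open Scope classical_set_scope.
Local Open Scope ring_scope.

(** * Weighted sums over a countable state space *)

Section WeightedSum.
Context {R : realType} {T : choiceType} (mu : T -> R).
Implicit Types g h : T -> R.

(** For a probability [mu] and [g >= 0] this is the mean of [g] in [0, +oo]; as a supremum of finite
    partial sums, it is handled through finite sets. *)
Definition wsum g : \bar R := \esum_(e in [set: T]) (mu e * g e)%:E.

Lemma wsum_ge0 g : (forall e, 0 <= mu e * g e) -> (0 <= wsum g)%E.
Proof. by move=> g0; apply: esum_ge0 => e _; rewrite lee_fin. Qed.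

Lemma le_wsum g h : (forall e, mu e * g e <= mu e * h e) -> (wsum g <= wsum h)%E.
Proof. by move=> gh; apply: le_esum => e _; rewrite lee_fin. Qed.

Lemma wsumD g h : (forall e, 0 <= mu e * g e) -> (forall e, 0 <= mu e * h e) ->
  wsum (fun e => g e + h e) = (wsum g + wsum h)%E.
Proof.
move=> g0 h0; rewrite /wsum -esumD => [|e _|e _]; rewrite ?lee_fin//.
by apply: eq_esum => e _; rewrite mulrDr EFinD.
Qed.

Lemma wsum_sum (I : choiceType) (r : seq I) (g : I -> T -> R) :
  (forall i e, 0 <= mu e * g i e) ->
  wsum (fun e => \sum_(i <- r) g i e) = (\sum_(i <- r) wsum (g i))%E.
Proof.
move=> g0; rewrite /wsum -esum_sum => [|e i _ _]; rewrite ?lee_fin//.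
by apply: eq_esum => e _; rewrite mulr_sumr sumEFin.
Qed.

Lemma wsum_ge_fset g (F : {fset T}) :
  ((\sum_(e <- F) mu e * g e)%:E <= wsum g)%E.
Proof.
rewrite -sumEFin; apply: ereal_sup_ubound; exists [set` F] => /=.
  by split; [exact: finite_fset|].
by rewrite fsbig_finite ?set_fsetK//; exact: finite_fset.
Qed.

Lemma wsum_le g (M : \bar R) :
  (forall F : {fset T}, ((\sum_(e <- F) mu e * g e)%:E <= M)%E) -> (wsum g <= M)%E.
Proof.
move=> gM; apply: ge_ereal_sup => /= _ [X [finX _]] <-.
by rewrite fsbig_finite//= sumEFin.
Qed.

Lemma wsum_approx g (s eps : R) : wsum g = s%:E -> 0 < eps ->
  exists F : {fset T}, s - eps <= \sum_(e <- F) mu e * g e.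
Proof.
move=> gs eps0; apply: contrapT => /forallNP noF.
have : (wsum g <= (s - eps)%:E)%E.
  by apply: wsum_le => F; rewrite lee_fin ltW// ltNge; apply/negP/noF.
by rewrite gs lee_fin; lra.
Qed.

Lemma wsumZ_le (c : R) g : 0 <= c -> (wsum (fun e => c * g e)%R <= c%:E * wsum g)%E.
Proof.
move=> c0; apply: wsum_le => F.
under eq_bigr do rewrite mulrCA.
by rewrite -mulr_sumr EFinM lee_wpmul2l ?lee_fin// wsum_ge_fset.
Qed.

Lemma wsumZ (c : R) g : 0 <= c -> wsum (fun e => c * g e)%R = (c%:E * wsum g)%E.
Proof.
rewrite le_eqVlt => /predU1P[<-|c0].
  by rewrite mul0e /wsum esum1// => e _; rewrite mul0r mulr0.
apply/eqP; rewrite eq_le (wsumZ_le _ _ (ltW c0))/=.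
have /wsumZ_le gc : 0 <= c^-1 by rewrite invr_ge0 ltW.
rewrite -lee_pdivlMl//; apply: le_trans (gc _); apply: le_wsum => e.
by rewrite mulKf// gt_eqF.
Qed.

Lemma wsum_fin g (M : R) : (forall e, 0 <= mu e * g e) -> (wsum g <= M%:E)%E ->
  exists2 s, 0 <= s & wsum g = s%:E.
Proof.
move=> /wsum_ge0; case: (wsum g) => //= r.
by rewrite lee_fin => r0 _; exists r.
Qed.

(* Tail estimate replacing dominated convergence: on a finite set carrying all but [eps / 2]
   of the sum, [g * min n g <= g ^ 2] does not grow with [n]. *)
Lemma wsum_min_small g (eps : R) : (forall e, 0 <= mu e) -> (forall e, 0 <= g e) ->
    (wsum g < +oo)%E -> 0 < eps ->
  exists2 n : R, 1 <= n & (wsum (fun e => g e * Num.min n (g e))%R <= (n * eps)%:E)%E.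
Proof.
move=> mu0 g0 gfin eps0.
have [s gs] : exists s, wsum g = s%:E.
  have : (0 <= wsum g)%E by apply: wsum_ge0 => e; rewrite mulr_ge0.
  by move: gfin; case: (wsum g) => //= r _ _; exists r.
have [|F Fs] := wsum_approx _ _ (eps / 2) gs; first lra.
pose c := \sum_(e <- F) mu e * (g e * g e).
have c0 : 0 <= c by apply: sumr_ge0 => e _; rewrite !mulr_ge0.
(* This makes [c <= n * eps / 2]; [c] bounds the contribution of [F], whatever [n] is. *)
pose n := 1 + 2 * c / eps.
have n0 : 1 <= n by rewrite lerDl divr_ge0 ?(ltW eps0)// mulr_ge0.
exists n => //.
have minn0 e : 0 <= Num.min n (g e) by rewrite le_min g0; lra.
have lemin e : Num.min n (g e) <= n by rewrite ge_min lexx.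
(* The first sum is bounded above through a lower bound on its complement to [n * s], which the
   finite set [F] provides. *)
have split_n : (wsum (fun e => g e * Num.min n (g e))%R
    + wsum (fun e => g e * (n - Num.min n (g e)))%R = (n * s)%:E)%E.
  rewrite EFinM -gs -wsumZ; last lra.
  rewrite -wsumD => [|e|e]; first by congr wsum; apply/funext => e; ring.
    by rewrite !mulr_ge0.
  by rewrite !mulr_ge0// subr_ge0.
have rest : ((n * (s - eps / 2) - c)%:E
    <= wsum (fun e => g e * (n - Num.min n (g e)))%R)%E.
  apply: le_trans (wsum_ge_fset _ F); rewrite lee_fin.
  apply: (@le_trans _ _ (\sum_(e <- F) (n * (mu e * g e) - mu e * (g e * g e)))).
    rewrite sumrB -mulr_sumr lerB// ler_wpM2l//; lra.
  apply: ler_sum => e _.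
  have -> : n * (mu e * g e) - mu e * (g e * g e) = mu e * (g e * (n - g e)) by ring.
  by rewrite !ler_wpM2l// lerB// ge_min lexx orbT.
have neps : n * (eps / 2) >= c.
  rewrite /n mulrDl mul1r.
  have -> : 2 * c / eps * (eps / 2) = c by field; rewrite gt_eqF.
  lra.
move: split_n rest.
case: (wsum (fun e => g e * (n - Num.min n (g e)))) => [r||]//.
  case: (wsum _) => [q||]//; rewrite -EFinD !lee_fin => -[] qr; lra.
by case: (wsum _).
Qed.

End WeightedSum.

(** * Stationary measures and truncated linear observables *)

Lemma exchange_esum {R : realType} {T1 T2 : choiceType} (a : T1 -> T2 -> \bar R) :
  (forall i j, (0 <= a i j)%E) ->
  (\esum_(i in [set: T1]) \esum_(j in [set: T2]) a i j =
   \esum_(j in [set: T2]) \esum_(i in [set: T1]) a i j)%E.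
Proof.
move=> a0; rewrite (esum_esum (J := fun=> [set: T2]))//.
rewrite (esum_esum (J := fun=> [set: T1]))//.
rewrite (reindex_esum ([set: T2] `*`` (fun=> [set: T1])) _ (fun x => (x.2, x.1)))//.
split=> //=.
- by move=> [i1 i2] [j1 j2] /= _ _ [] -> ->.
- by move=> [i1 i2] _; exists (i2, i1).
Qed.

Lemma esum_indic1 {R : realType} {T : choiceType} (x : T) (a : \bar R) :
  (0 <= a)%E -> (\esum_(y in [set: T]) (if x == y then a else 0) = a)%E.
Proof.
move=> a0; rewrite -[RHS](@esum_set1 _ _ x (fun=> a) a0) [RHS]esum_mkcond.
by apply: eq_esum => y _; rewrite in_set1 eq_sym.
Qed.

(** Tangent inequality for the convex function [u |-> ((n - u)^+)^2], of derivative
    [-2 (n - u)^+]. *)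
Lemma sqr_pospart_ge {R : realType} (n u v : R) :
  Num.max 0 (n - u) ^+ 2 - 2 * Num.max 0 (n - u) * (v - u) <= Num.max 0 (n - v) ^+ 2.
Proof.
have -> : v - u = (n - u) - (n - v) by ring.
move: (n - u) (n - v) => a b.
have := sqr_ge0 (a - b); have := sqr_ge0 a.
rewrite !expr2 => a2 ab2.
by have [a0|a0] := leP 0 a; have [b0|b0] := leP 0 b; nra.
Qed.

(** That derivative is 2-Lipschitz, so the remainder of the linearisation is at most [(v - u)^2]. *)
Lemma sqr_pospart_le {R : realType} (n u v : R) :
  Num.max 0 (n - v) ^+ 2 <=
  Num.max 0 (n - u) ^+ 2 - 2 * Num.max 0 (n - u) * (v - u) + (v - u) ^+ 2.
Proof.
have -> : v - u = (n - u) - (n - v) by ring.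
move: (n - u) (n - v) => a b.
have := sqr_ge0 (a - b); have := sqr_ge0 b.
rewrite !expr2 => b2 ab2.
by have [a0|a0] := leP 0 a; have [b0|b0] := leP 0 b; nra.
Qed.

(** * Weak form of global balance *)

Section StationaryChain.
Context {R : realType} {T : choiceType}.
Variables (tr : T -> seq (R * T)) (ok : T -> Prop) (mu : T -> R).

Let out e := \sum_(t <- tr e | t.2 != e) t.1.
Let rate e e' := \sum_(t <- tr e | t.2 == e') t.1.

Hypothesis tr_ge0 : forall e t, ok e -> t \in tr e -> 0 <= t.1.
Hypothesis tr_ok : forall e t, ok e -> t \in tr e -> t.1 != 0 -> ok t.2.
Hypothesis mu_ge0 : forall e, 0 <= mu e.
Hypothesis mu_ok : forall e, ~ ok e -> mu e = 0.
Hypothesis mu1 : (\esum_(e in [set: T]) (mu e)%:E = 1)%E.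
Hypothesis balance : forall e', ok e' ->
  ((mu e' * out e')%:E =
   \esum_(e in [set e | ok e /\ e != e']) (mu e * rate e e')%:E)%E.

Lemma mu_mul_ge0 (g : T -> R) : (forall e, ok e -> 0 <= g e) -> forall e, 0 <= mu e * g e.
Proof.
move=> g0 e; have [oke|/mu_ok ->] := pselect (ok e); last by rewrite mul0r.
by rewrite mulr_ge0 ?g0.
Qed.

Lemma le_wsum_ok (g h : T -> R) : (forall e, ok e -> g e <= h e) ->
  (wsum mu g <= wsum mu h)%E.
Proof.
move=> gh; apply: le_wsum => e.
have [oke|/mu_ok ->] := pselect (ok e); last by rewrite !mul0r.
by rewrite ler_wpM2l ?gh.
Qed.

Lemma wsum_cst (c : R) : 0 <= c -> wsum mu (fun=> c) = c%:E.
Proof.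
move=> c0; have -> : (fun=> c) = (fun _ : T => c * 1) by apply/funext => e; rewrite mulr1.
by rewrite wsumZ// /wsum; under eq_esum do rewrite mulr1; rewrite mu1 mule1.
Qed.

Lemma weak_balance (phi : T -> R) : (forall e, 0 <= phi e) ->
  wsum mu (fun e => phi e * out e) =
  wsum mu (fun e => \sum_(t <- tr e | t.2 != e) t.1 * phi t.2).
Proof.
move=> phi0.
(* Flow from [e] to [e'] tested against [phi], extended by 0 so that both sums run over the whole
   type and Tonelli applies. *)
pose F e' e : \bar R := if [&& `[< ok e >], `[< ok e' >] & e != e']
  then (mu e * rate e e' * phi e')%:E else 0%E.
have rate_ge0 e e' : ok e -> 0 <= rate e e'.
  move=> oke; rewrite /rate big_seq_cond; apply: sumr_ge0 => t /andP[te _].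
  exact: tr_ge0 te.
have F0 e' e : (0 <= F e' e)%E.
  rewrite /F; case: ifP => // /and3P[/asboolP oke _ _].
  by rewrite lee_fin !mulr_ge0 ?rate_ge0.
rewrite {1}/wsum (eq_esum (b := fun e' => \esum_(e in [set: T]) F e' e)%E); last first.
  move=> e' _; have [oke'|nok] := pselect (ok e'); last first.
    rewrite mu_ok// mul0r esum1// => e _.
    by rewrite /F (asboolF nok)/= andbF.
  rewrite mulrCA EFinM balance// esum_mkcond.
  pose m e := if `[< ok e >] && (e != e') then mu e * rate e e' else 0.
  transitivity (wsum m (fun=> phi e' * 1)).
    rewrite (wsumZ _ _ (fun=> 1) (phi0 e')); congr (_ * _)%E.
    apply: eq_esum => e _; rewrite mulr1 /m.
    have -> : (e \in [set e | ok e /\ e != e']) = `[< ok e >] && (e != e').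
      apply/idP/andP; rewrite in_setE /= => -[]; first by move=> /asboolP.
      by move=> /asboolP.
    by case: ifP.
  apply: eq_esum => e _; rewrite /F /m (asboolT oke')/=.
  by case: ifP => _; rewrite mulr1 ?mul0r.
rewrite exchange_esum//; apply: eq_esum => e _.
have [oke|nok] := pselect (ok e); last first.
  by rewrite mu_ok// mul0r esum1// => e' _; rewrite /F (asboolF nok).
rewrite (eq_esum (b := fun e' => (\sum_(t <- tr e | (t \in tr e) && (t.2 != e))
    if t.2 == e' then (mu e * (t.1 * phi t.2))%:E else 0)%E)); last first.
  move=> e' _; rewrite /F (asboolT oke)/=.
  case: ifPn => [/andP[/asboolP oke' ee']|H].
    rewrite -mulrA mulr_suml mulr_sumr -sumEFin -big_seq_cond.
    rewrite big_mkcond [RHS]big_mkcond/=; apply: eq_bigr => t _.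
    by case: (eqVneq t.2 e') => [->|_]; rewrite ?(eq_sym e') ?ee' ?if_same.
  rewrite big1// => t /andP[te t2e]; case: eqP => // t2; subst e'.
  (* A transition that leaves [ok] has rate 0, so extending [F] by 0 loses nothing. *)
  have [->|t1] := eqVneq t.1 0; first by rewrite mul0r mulr0.
  by move: H; rewrite (asboolT (tr_ok _ _ oke te t1)) eq_sym t2e.
rewrite esum_sum => [|e' t _ /andP[te _]]; last first.
  by case: ifP => _//; rewrite lee_fin !mulr_ge0// (tr_ge0 _ _ oke te).
rewrite mulr_sumr -sumEFin -big_seq_cond big_seq_cond [RHS]big_seq_cond.
apply: eq_bigr => t /andP[te _].
by rewrite esum_indic1// lee_fin !mulr_ge0// (tr_ge0 _ _ oke te).
Qed.

(** * Truncations [(n - f)^+] of an observable [f] comparable with [G] *)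

Variables (f G : T -> R) (W J K : R).
Hypothesis G_ge1 : forall e, 1 <= G e.
Hypothesis f_ge : forall e, G e <= f e.
Hypothesis f_le : forall e, f e <= W * G e.
Hypothesis jump_le : forall e t, ok e -> t \in tr e -> t.1 != 0 -> `|f t.2 - f e| <= J.
Hypothesis rate_le : forall e, ok e -> \sum_(t <- tr e) t.1 <= K * G e ^+ 2.

Let Lf e := \sum_(t <- tr e) t.1 * (f t.2 - f e).
Let p n e := Num.max 0 (n - f e).

Let phi_jump n e := \sum_(t <- tr e | t.2 != e) t.1 * p n t.2 ^+ 2.

(** Transitions back to [e] have zero increment, so the last sum may run over all of [tr e]. *)
Lemma phi_jumpE n e : phi_jump n e =
  p n e ^+ 2 * out e + \sum_(t <- tr e) t.1 * (p n t.2 ^+ 2 - p n e ^+ 2).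
Proof.
rewrite (bigID (fun t => t.2 == e))/= [X in _ + (X + _)]big1 ?add0r.
  by rewrite /out mulr_sumr -big_split/=; apply: eq_bigr => t _; ring.
by move=> t /eqP ->; rewrite subrr mulr0.
Qed.

Lemma phi_jump_ge n e : ok e ->
  p n e ^+ 2 * out e <= phi_jump n e + 2 * p n e * Lf e.
Proof.
move=> oke; rewrite phi_jumpE -addrA lerDl /Lf mulr_sumr -big_split/= big_seq.
apply: sumr_ge0 => t te.
have := sqr_pospart_ge n (f e) (f t.2); rewrite -/(p n e) -/(p n t.2).
have := tr_ge0 _ _ oke te.
set q := p n t.2; set r := p n e; set d := f t.2 - f e => t0 H.
have -> : t.1 * (q ^+ 2 - r ^+ 2) + 2 * r * (t.1 * d) =
  t.1 * (q ^+ 2 - (r ^+ 2 - 2 * r * d)) by ring.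
by rewrite mulr_ge0// subr_ge0.
Qed.

Lemma phi_jump_le n e : ok e -> phi_jump n e + 2 * p n e * Lf e <=
  p n e ^+ 2 * out e + (if f e < n + J then J ^+ 2 * (K * G e ^+ 2) else 0).
Proof.
move=> oke; rewrite phi_jumpE -addrA lerD2l /Lf mulr_sumr -big_split/=.
pose d (t : R * T) := f t.2 - f e.
have H t : t \in tr e -> t.1 * (p n t.2 ^+ 2 - p n e ^+ 2) + 2 * p n e * (t.1 * d t)
    <= if f e < n + J then J ^+ 2 * t.1 else 0.
  move=> te; have t0 := tr_ge0 _ _ oke te.
  have [->|t1] := eqVneq t.1 0; first by rewrite !(mul0r, mulr0) addr0 if_same.
  have := jump_le _ _ oke te t1; rewrite -/(d t) ler_norml => /andP[dJ1 dJ2].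
  have := sqr_pospart_le n (f e) (f t.2); rewrite -/(p n e) -/(p n t.2) -/(d t).
  set q := p n t.2; set r := p n e => H.
  have -> : t.1 * (q ^+ 2 - r ^+ 2) + 2 * r * (t.1 * d t) =
    t.1 * (q ^+ 2 - r ^+ 2 + 2 * r * d t) by ring.
  case: ltP => fn.
    rewrite mulrC ler_wpM2r//; apply: (@le_trans _ _ (d t ^+ 2)); first lra.
    by rewrite -subr_ge0 subr_sqr mulr_ge0//; lra.
  (* From [f e >= n + J] no jump brings [f] below [n], so both truncations vanish. *)
  have -> : r = 0 by rewrite /r /p max_l//; lra.
  have -> : q = 0 by rewrite /q /p max_l//; move: dJ1; rewrite /d; lra.
  by rewrite expr0n/= subrr mulr0 mul0r addr0 mulr0.
rewrite big_seq; apply: le_trans (ler_sum _ H) _.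
case: ifP => _; last by rewrite big1.
by rewrite -mulr_sumr -big_seq ler_wpM2l ?rate_le// sqr_ge0.
Qed.

(** Where [p n e] is positive, [G e <= f e < n], so the exit rate is at most |K| n^2. *)
Lemma wsum_out_fin n : 0 <= n ->
  exists2 M, 0 <= M & wsum mu (fun e => p n e ^+ 2 * out e) = M%:E.
Proof.
move=> n0.
have out0 e : ok e -> 0 <= out e.
  move=> oke; rewrite /out big_seq_cond; apply: sumr_ge0 => t /andP[te _].
  exact: tr_ge0 te.
apply: (@wsum_fin _ _ _ _ (n ^+ 2 * (`|K| * n ^+ 2))).
  by apply: mu_mul_ge0 => e oke; rewrite mulr_ge0 ?sqr_ge0 ?out0.
rewrite -wsum_cst; last by rewrite !mulr_ge0 ?sqr_ge0.
apply: le_wsum_ok => e oke.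
have Ge := G_ge1 e; have fe := f_ge e.
have [fn|fn] := leP (n - f e) 0.
  by rewrite /p max_l// expr0n/= mul0r !mulr_ge0 ?sqr_ge0.
rewrite ler_pM ?sqr_ge0 ?out0//.
  by rewrite /p max_r ?(ltW fn)// lerXn2r ?nnegrE//; lra.
apply: (@le_trans _ _ (\sum_(t <- tr e) t.1)).
  rewrite /out [leRHS](bigID (fun t => t.2 == e))/= lerDr big_seq_cond.
  by apply: sumr_ge0 => t /andP[te _]; exact: tr_ge0 te.
apply: (le_trans (rate_le _ oke)); apply: (@le_trans _ _ (`|K| * G e ^+ 2)).
  by rewrite ler_wpM2r ?sqr_ge0// ler_norm.
by rewrite ler_wpM2l// lerXn2r ?nnegrE//; lra.
Qed.

(** Weak balance for [p n ^ 2] and the tangent inequality bound the mean of [p n * h] by [n * C],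
    two equal finite terms cancelling. Dividing by [n] and letting [n] grow turns [p n / n] into
    1. *)
Theorem wsum_drift (h : T -> R) (C : R) : 0 <= C -> (forall e, ok e -> 0 <= h e) ->
  (forall e, ok e -> Lf e <= C - h e) -> (wsum mu h <= C%:E)%E.
Proof.
move=> C0 h0 drift.
have f0 e : 0 <= f e by have := G_ge1 e; have := f_ge e; lra.
have mh0 := mu_mul_ge0 _ h0.
have bound n : 0 <= n -> (wsum mu (fun e => p n e * h e)%R <= (n * C)%:E)%E.
  move=> n0.
  have p0 e : 0 <= p n e by rewrite le_max lexx.
  have [M M0 MS] := wsum_out_fin _ n0.
  have wb := weak_balance (fun e => p n e ^+ 2) (fun e => sqr_ge0 _).
  rewrite MS in wb.
  have step : (wsum mu (fun e => p n e ^+ 2 * out e + 2 * (p n e * h e))%R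
      <= wsum mu (fun e => phi_jump n e + 2 * n * C)%R)%E.
    apply: le_wsum_ok => e oke.
    apply: (@le_trans _ _ (phi_jump n e + 2 * p n e * Lf e + 2 * (p n e * h e))).
      by rewrite lerD2r phi_jump_ge.
    rewrite -addrA lerD2l.
    have pn : p n e <= n by rewrite ge_max n0 gerBl f0.
    have := ler_wpM2l (p0 e) (drift e oke).
    have := ler_wpM2r C0 pn.
    lra.
  move: step; rewrite wsumD; first last.
  - by apply: mu_mul_ge0 => e oke; rewrite !mulr_ge0 ?h0.
  - apply: mu_mul_ge0 => e oke; rewrite mulr_ge0 ?sqr_ge0//.
    rewrite /out big_seq_cond; apply: sumr_ge0 => t /andP[te _].
    exact: tr_ge0 te.
  rewrite wsumD; first last.
  - by move=> e; rewrite !mulr_ge0.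
  - apply: mu_mul_ge0 => e oke; rewrite /phi_jump big_seq_cond.
    apply: sumr_ge0 => t /andP[te _]; rewrite mulr_ge0 ?sqr_ge0//.
    exact: tr_ge0 te.
  rewrite -[X in (_ <= X + _)%E]wb MS wsum_cst ?mulr_ge0// leeD2lE//.
  rewrite wsumZ//; have -> : (2 * n * C)%:E = (2%:E * (n * C)%:E)%E by rewrite -EFinM mulrA.
  by rewrite lee_pmul2l.
apply: wsum_le => F; rewrite lee_fin.
set s := \sum_(e <- F) _.
pose c := \sum_(e <- F) mu e * (f e * h e).
(* On the finite set [F], replacing [p n e] by the smaller [n - f e] costs only [c], uniformly in
   [n]. *)
have key n : 0 <= n -> n * s - c <= n * C.
  move=> n0; rewrite -lee_fin; apply: le_trans (bound n n0).
  apply: le_trans (wsum_ge_fset _ _ F); rewrite lee_fin /s /c mulr_sumr -sumrB.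
  apply: ler_sum => e _.
  have -> : n * (mu e * h e) - mu e * (f e * h e) = (n - f e) * (mu e * h e) by ring.
  by rewrite [leRHS]mulrCA ler_wpM2r// le_max lexx orbT.
rewrite leNgt; apply/negP => Cs.
have c0 : 0 <= c.
  by apply: sumr_ge0 => e _; rewrite mulrCA mulr_ge0.
(* For this [n] one has [n * (s - C) = c + 1], against [key]. *)
have := key ((c + 1) / (s - C)); rewrite divr_ge0; [move=> /(_ isT)|lra|lra].
set n := (c + 1) / _ => H.
have : n * (s - C) = c + 1 by rewrite /n mulfVK//; lra.
lra.
Qed.

(** By weak balance the increment of [p n ^ 2] has mean zero; pointwise it is [-2 n (a - b)] up to a
    multiple of [G * min (n, G)], whose mean [wsum_min_small] makes small relative to [n]. Splitting
    the drift as [a - b] keeps all sums nonnegative. *)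
Theorem wsum_generator (a b : T -> R) (K' : R) :
    0 <= K' -> 0 <= J ->
    (forall e, ok e -> 0 <= a e <= K' * G e) ->
    (forall e, ok e -> 0 <= b e <= K' * G e) ->
    (forall e, ok e -> Lf e = a e - b e) ->
    (wsum mu G < +oo)%E ->
  wsum mu a = wsum mu b.
Proof.
move=> K'0 J0 ha hb LfE Gfin.
have G0 e : 0 <= G e by have := G_ge1 e; lra.
have mG0 e : 0 <= mu e * G e by rewrite mulr_ge0.
have [sG sG0 GE] : exists2 s, 0 <= s & wsum mu G = s%:E.
  move: Gfin; have := wsum_ge0 _ _ mG0; case: (wsum mu G) => //= r.
  by rewrite lee_fin => r0 _; exists r.
have fin c : (forall e, ok e -> 0 <= c e <= K' * G e) -> exists2 s, 0 <= s & wsum mu c = s%:E.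
  move=> hc; apply: (@wsum_fin _ _ _ _ (K' * sG)).
    by apply: mu_mul_ge0 => e /hc /andP[].
  by rewrite EFinM -GE -wsumZ//; apply: le_wsum_ok => e /hc /andP[].
have [sa sa0 aE] := fin _ ha; have [sb sb0 bE] := fin _ hb.
(* The first term pays for replacing [p n e] by [n] in the linear part, the second for the quadratic
   remainder. *)
pose K2 := 2 * `|W| * K' + J ^+ 2 * `|K| * (1 + J).
have K20 : 0 <= K2 by rewrite addr_ge0// !mulr_ge0 ?sqr_ge0//; lra.
pose g n e := G e * Num.min n (G e).
have pointwise n e : 1 <= n -> ok e ->
  `|phi_jump n e - p n e ^+ 2 * out e + 2 * n * (a e - b e)| <= K2 * g n e.
  move=> n1 oke; rewrite -LfE//.
  have lo := phi_jump_ge n _ oke; have up := phi_jump_le n _ oke.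
  have Ge := G_ge1 e; have fe := f_ge e; have fW := f_le e.
  have W1 : 1 <= W by rewrite -(@ler_pM2r _ (G e)) ?mul1r//; lra.
  have m0 : 0 <= Num.min n (G e) by rewrite le_min G0 andbT; lra.
  have g0 : 0 <= g n e by rewrite mulr_ge0.
  have err : `|2 * (n - p n e) * Lf e| <= 2 * `|W| * K' * g n e.
    have p0 : 0 <= p n e by rewrite le_max lexx.
    have pf : n - f e <= p n e by rewrite le_max lexx orbT.
    have pn : p n e <= n by rewrite ge_max gerBl; apply/andP; split; lra.
    have Wn : n <= W * n by rewrite ler_peMl//; lra.
    (* Indeed [n - p n e = min (n, f e)], while [f <= W * G] and [W >= 1]. *)
    have np : 0 <= n - p n e <= W * Num.min n (G e).
      by case: (leP n (G e)) => nG; apply/andP; split; lra.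
    have L : `|Lf e| <= K' * G e.
      rewrite LfE// ler_norml; move: (ha _ oke) (hb _ oke) => /andP[? ?] /andP[? ?].
      by apply/andP; split; lra.
    case/andP: np => np0 npW.
    rewrite normrM (ger0_norm (x := 2 * _)) ?mulr_ge0// (ger0_norm (x := W)); last lra.
    have -> : 2 * W * K' * g n e = 2 * (W * Num.min n (G e)) * (K' * G e) by rewrite /g; ring.
    by rewrite ler_pM// ?mulr_ge0// ler_wpM2l.
  have sq : (if f e < n + J then J ^+ 2 * (K * G e ^+ 2) else 0)
      <= J ^+ 2 * `|K| * (1 + J) * g n e.
    case: ifP => [fn|_]; last by rewrite !mulr_ge0 ?sqr_ge0//; lra.
    have -> : J ^+ 2 * `|K| * (1 + J) * g n e = J ^+ 2 * (`|K| * ((1 + J) * g n e)) by ring.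
    apply: ler_wpM2l; first exact: sqr_ge0.
    apply: (@le_trans _ _ (`|K| * G e ^+ 2)).
       by rewrite ler_wpM2r ?sqr_ge0// ler_norm.
    rewrite ler_wpM2l// /g mulrCA expr2 ler_wpM2l//.
    have JG : 0 <= J * G e by rewrite mulr_ge0.
    (* Since [n >= 1], [G e <= f e < n + J <= (1 + J) * n], hence
       [G e <= (1 + J) * min (n, G e)]. *)
    have Jn : J <= J * n by rewrite ler_peMr.
    by case: (leP n (G e)) => nG; rewrite mulrDl mul1r; lra.
  move: err; rewrite !ler_norml => /andP[e1 e2].
  have -> : K2 * g n e = 2 * `|W| * K' * g n e + J ^+ 2 * `|K| * (1 + J) * g n e.
    by rewrite /K2 mulrDl.
  have gJ : 0 <= J ^+ 2 * `|K| * (1 + J) * g n e by rewrite !mulr_ge0 ?sqr_ge0//; lra.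
  have -> : 2 * n * Lf e = 2 * p n e * Lf e + 2 * (n - p n e) * Lf e by ring.
  have up' := le_trans up (lerD (lexx _) sq).
  move: up' lo e1 e2 gJ.
  set B := J ^+ 2 * _ * _ * _; set A := 2 * `|W| * _ * _; set D := 2 * (n - p n e) * _.
  set Q := 2 * p n e * Lf e; set P := p n e ^+ 2 * out e; set F := phi_jump n e.
  by move=> *; apply/andP; split; lra.
clearbody K2.
have limit x y : (forall eps, 0 < eps ->
    exists2 n, 1 <= n & 2 * n * x <= 2 * n * y + K2 * (n * eps)) -> x <= y.
  move=> H; rewrite leNgt; apply/negP => yx.
  (* This choice of [eps] gives [K2 * eps <= x - y], whereas the assumption forces
     [2 * (x - y) <= K2 * eps]. *)
  have e0 : 0 < (x - y) / (K2 + 1) by rewrite divr_gt0//; lra.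
  have [n n1] := H _ e0.
  have -> : K2 * (n * ((x - y) / (K2 + 1))) = n * ((x - y) * (K2 / (K2 + 1))) by ring.
  have : K2 / (K2 + 1) <= 1 by rewrite ler_pdivrMr; lra.
  set q := K2 / _ => q1 q2.
  have n0 : 0 <= n by lra.
  have xy0 : 0 <= x - y by lra.
  have := ler_wpM2l n0 (ler_wpM2l xy0 q1).
  have : 0 < n * (x - y) by rewrite mulr_gt0//; lra.
  by move: q2; rewrite mulr1 !mulrBr !mulrBl; lra.
have out0 n e : ok e -> 0 <= p n e ^+ 2 * out e.
  move=> oke; rewrite mulr_ge0 ?sqr_ge0//.
  rewrite /out big_seq_cond; apply: sumr_ge0 => t /andP[te _].
  exact: tr_ge0 te.
have jump0 n e : ok e -> 0 <= phi_jump n e.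
  move=> oke; rewrite /phi_jump big_seq_cond; apply: sumr_ge0 => t /andP[te _].
  by rewrite mulr_ge0 ?sqr_ge0//; exact: tr_ge0 te.
have balanced n := weak_balance (fun e => p n e ^+ 2) (fun e => sqr_ge0 _).
have g0 n e : 1 <= n -> 0 <= g n e.
  by move=> n1; rewrite mulr_ge0// le_min G0 andbT; lra.
have compare (u v : R -> T -> R) (c d : T -> R) sc sd :
    (forall n e, ok e -> 0 <= u n e) -> (forall n e, ok e -> 0 <= v n e) ->
    (forall n, 0 <= n -> exists2 M : R, wsum mu (u n) = M%:E & wsum mu (v n) = M%:E) ->
    (forall e, ok e -> 0 <= c e) -> (forall e, ok e -> 0 <= d e) ->
    wsum mu c = sc%:E -> wsum mu d = sd%:E ->
    (forall n e, 1 <= n -> ok e ->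
      u n e + 2 * n * c e <= v n e + 2 * n * d e + K2 * g n e) ->
    sc <= sd.
  move=> u0 v0 uv c0 d0 cE dE H; apply: limit => eps eps0.
  have [n n1 gn] := wsum_min_small _ _ _ mu_ge0 G0 Gfin eps0.
  have n20 : 0 <= 2 * n by lra.
  have [|M uM vM] := uv n; first lra.
  exists n => //; rewrite -(lerD2l M) addrA.
  have : (wsum mu (fun e => u n e + 2 * n * c e)%R <=
      wsum mu (fun e => v n e + 2 * n * d e + K2 * g n e)%R)%E.
    by apply: le_wsum_ok => e; exact: H.
  rewrite wsumD; first last.
  - by apply: mu_mul_ge0 => e oke; rewrite mulr_ge0 ?c0.
  - by apply: mu_mul_ge0 => e; exact: u0.
  rewrite wsumD; first last.
  - by apply: mu_mul_ge0 => e oke; rewrite mulr_ge0 ?g0.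
  - by apply: mu_mul_ge0 => e oke; rewrite addr_ge0 ?v0// mulr_ge0 ?d0.
  rewrite wsumD; first last.
  - by apply: mu_mul_ge0 => e oke; rewrite mulr_ge0 ?d0.
  - by apply: mu_mul_ge0 => e; exact: v0.
  rewrite !wsumZ// uM vM cE dE => le1.
  rewrite -lee_fin; apply: (le_trans le1).
  by rewrite 2!EFinD leeD// EFinM lee_wpmul2l// lee_fin.
rewrite aE bE; congr (_%:E); apply/eqP; rewrite eq_le; apply/andP; split.
- apply: (compare phi_jump (fun n e => p n e ^+ 2 * out e) a b) => //.
  + by move=> n n0; have [M _ ME] := wsum_out_fin _ n0; exists M; rewrite -?balanced.
  + by move=> e /ha /andP[].
  + by move=> e /hb /andP[].
  + move=> n e n1 oke; have := pointwise n e n1 oke.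
    by rewrite ler_norml => /andP[_]; lra.
- apply: (compare (fun n e => p n e ^+ 2 * out e) phi_jump b a) => //.
  + by move=> n n0; have [M _ ME] := wsum_out_fin _ n0; exists M; rewrite -?balanced.
  + by move=> e /hb /andP[].
  + by move=> e /ha /andP[].
  + move=> n e n1 oke; have := pointwise n e n1 oke.
    by rewrite ler_norml => /andP[+ _]; lra.
Qed.

End StationaryChain.

(** * The switching system *)

Lemma sum_layers {V : nmodType} (F : 'I_2 -> V) : \sum_i F i = F layer0 + F layer1.
Proof.
rewrite big_ord_recl big_ord1; congr (F _ + F _); exact: val_inj.
Qed.

Lemma layerP (P : 'I_2 -> Prop) : P layer0 -> P layer1 -> forall i, P i.
Proof.
by move=> P0 P1 [[|[|//]] i]; [move: P0|move: P1]; congr P; exact: val_inj.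
Qed.

Lemma sum_if_val_eq {V : nmodType} {n : nat} (F : 'I_n -> V) (x : 'I_n) (m : nat) :
  m = x -> \sum_y (if val y == m then F y else 0) = F x.
Proof.
move=> ->; rewrite -big_mkcond (big_pred1 x)//.
Qed.

Lemma sum_bonds {V : nmodType} {M : nat} (F : 'I_M.+1 -> 'I_M.+1 -> V) :
  \sum_(x : 'I_M.+1) (if (x.+1 < M.+1)%N then F x (insubd x x.+1) else 0) =
  \sum_(j < M) F (inord j) (inord j.+1).
Proof.
rewrite big_ord_recr/= ltnn addr0; apply: eq_bigr => j _ /=.
rewrite ltnS ltn_ord; congr F; apply: val_inj; first by rewrite /= inordK// ltnS ltnW.
by rewrite val_insubd ltnS ltn_ord /= inordK// ltnS.
Qed.

(** * Affine functions of the occupation numbers *)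

Section Affine.
Context {R : comNzRingType} {I : finType}.

(** Only the existence of coefficients matters: they are later split by sign. *)
Definition affine (g : (I -> R) -> R) :=
  exists c a, forall v, g v = c + \sum_k a k * v k.

Lemma affine_cst c : affine (fun=> c).
Proof.
by exists c, (fun=> 0) => v; rewrite big1 ?addr0// => k _; rewrite mul0r.
Qed.

Lemma affine_coord k : affine (fun v => v k).
Proof.
exists 0, (fun l => (l == k)%:R) => v; rewrite add0r (bigD1 k)//= eqxx mul1r.
by rewrite big1 ?addr0// => l /negPf ->; rewrite mul0r.
Qed.

Lemma affineD g h : affine g -> affine h -> affine (fun v => g v + h v).
Proof.
move=> [c [a gE]] [d [b hE]]; exists (c + d), (fun k => a k + b k) => v.
by rewrite gE hE addrACA -big_split; congr (_ + _); apply: eq_bigr => k _; rewrite mulrDl.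
Qed.

Lemma affineZ x g : affine g -> affine (fun v => x * g v).
Proof.
move=> [c [a gE]]; exists (x * c), (fun k => x * a k) => v.
by rewrite gE mulrDr mulr_sumr; congr (_ + _); apply: eq_bigr => k _; rewrite mulrA.
Qed.

Lemma affineZr x g : affine g -> affine (fun v => g v * x).
Proof.
move=> /(affineZ x) [c [a gE]]; exists c, a => v; by rewrite mulrC gE.
Qed.

Lemma affineB g h : affine g -> affine h -> affine (fun v => g v - h v).
Proof.
move=> ag /(affineZ (-1)) ah; have [c [a E]] := affineD _ _ ag ah.
by exists c, a => v; rewrite -E mulN1r.
Qed.

Lemma affine_sum (J : Type) (r : seq J) (g : J -> (I -> R) -> R) :
  (forall j, affine (g j)) -> affine (fun v => \sum_(j <- r) g j v).
Proof.
move=> ag; elim: r => [|j r IH].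
  by have [c [a E]] := affine_cst 0; exists c, a => v; rewrite -E big_nil.
by have [c [a E]] := affineD _ _ (ag j) IH; exists c, a => v; rewrite -E big_cons.
Qed.

End Affine.

(** * The generator on linear observables *)

Section Switching.
Context {R : realType} {M : nat}.
Variables (sigma eps gamma : R) (rhoL rhoR : 'I_2 -> R).
Let N := M.+1.
Implicit Types (e : config N) (k a b : 'I_2 * 'I_N) (w : 'I_2 * 'I_N -> R).

Local Notation tr := (@transitions R N sigma eps gamma rhoL rhoR).
Local Notation n e k := ((e k)%:R : R).

(** The codomain is general: in [nat] the formula counts transitions, in [R] it computes the
    generator. *)
Lemma sum_transitions {V : nmodType} (F : R * config N -> V) e :
  \sum_(t <- tr e) F t = \sum_(i : 'I_2) \sum_(x : 'I_N)
   ((if (x.+1 < N)%N then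
       let y : 'I_N := insubd x x.+1 in
       F (eps ^+ i * n e (i, x) * (1 + sigma * n e (i, y)), cmove e (i, x) (i, y)) +
       F (eps ^+ i * n e (i, y) * (1 + sigma * n e (i, x)), cmove e (i, y) (i, x))
     else 0)
    + F (gamma * n e (i, x) * (1 + sigma * n e (flip i, x)), cmove e (i, x) (flip i, x))
    + (if val x == 0%N then
         F (n e (i, x) * (1 + sigma * rhoL i), cdel e (i, x)) +
         F (rhoL i * (1 + sigma * n e (i, x)), Defs.cadd e (i, x)) else 0)
    + (if val x == M then
         F (n e (i, x) * (1 + sigma * rhoR i), cdel e (i, x)) +
         F (rhoR i * (1 + sigma * n e (i, x)), Defs.cadd e (i, x)) else 0)).
Proof.
rewrite /transitions big_flatten big_map big_enum; apply: eq_bigr => i _ /=.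
rewrite big_flatten big_map big_enum; apply: eq_bigr => x _ /=.
rewrite big_cat /= big_cons big_cat /= !addrA; congr (_ + _ + _ + _).
- by case: ifP => _; rewrite ?big_cons ?big_nil ?addr0.
- by case: ifP => _; rewrite ?big_cons ?big_nil ?addr0.
- by case: ifP => _; rewrite ?big_cons ?big_nil ?addr0.
Qed.

Lemma size_transitions e e' : size (tr e) = size (tr e').
Proof. by rewrite -!sum1_size !sum_transitions. Qed.

(* The generator acting on the linear observable [sum_k w k * eta k], evaluated at the
   occupation numbers [v]; the [sigma]-terms cancel pairwise. *)
Definition linear_generator w v : R := \sum_(i : 'I_2)
  (\sum_(j < M) eps ^+ i * (v (i, inord j) - v (i, inord j.+1))
                * (w (i, inord j.+1) - w (i, inord j))
   + \sum_x gamma * v (i, x) * (w (flip i, x) - w (i, x))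
   + (rhoL i - v (i, ord0)) * w (i, ord0)
   + (rhoR i - v (i, ord_max)) * w (i, ord_max)).

Definition weight w e : R := 1 + \sum_k w k * n e k.

Lemma weight_cadd w e a : weight w (Defs.cadd e a) = weight w e + w a.
Proof.
rewrite /weight (bigD1 a)//= [in RHS](bigD1 a)//= !ffunE eqxx.
rewrite (eq_bigr (fun k => w k * n e k)) => [|k /negPf ka]; last by rewrite !ffunE ka.
by rewrite -natr1; ring.
Qed.

Lemma weight_cdel w e a : (0 < e a)%N -> weight w (cdel e a) = weight w e - w a.
Proof.
move=> ea; rewrite /weight (bigD1 a)//= [in RHS](bigD1 a)//= !ffunE eqxx.
rewrite (eq_bigr (fun k => w k * n e k)) => [|k /negPf ka]; last by rewrite !ffunE ka.
by rewrite -[in RHS](prednK ea) -natr1; ring.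
Qed.

Lemma weight_cmove w e a b : (0 < e a)%N ->
  weight w (cmove e a b) = weight w e + (w b - w a).
Proof. by move=> ea; rewrite weight_cadd weight_cdel//; ring. Qed.

(** At an empty position [predn] removes nothing, but there the factor [n e a] makes the rate
    vanish. *)
Lemma jump_cmove w e a b c x :
  c * n e a * x * (weight w (cmove e a b) - weight w e) = c * n e a * x * (w b - w a).
Proof.
have [e0|ea] := posnP (e a); first by rewrite e0 mulr0 !mul0r.
by rewrite weight_cmove// addrC addKr.
Qed.

Lemma jump_cdel w e a x :
  n e a * x * (weight w (cdel e a) - weight w e) = n e a * x * - w a.
Proof.
have [e0|ea] := posnP (e a); first by rewrite e0 !mul0r.
by rewrite weight_cdel// addrC addKr.
Qed.

Lemma generator_weight w e :
  \sum_(t <- tr e) t.1 * (weight w t.2 - weight w e) =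
  linear_generator w (fun k => n e k).
Proof.
rewrite sum_transitions /linear_generator.
(* On bonds and at reservoirs the [sigma]-terms of opposite transitions cancel within each layer.
   Those of switching cancel only between the layers, so [ex] keeps them until both layers are
   added. *)
pose ex i x := gamma * n e (i, x) * (1 + sigma * n e (flip i, x)) * (w (flip i, x) - w (i, x)).
transitivity (\sum_(i : 'I_2)
  (\sum_(j < M) eps ^+ i * (n e (i, inord j) - n e (i, inord j.+1))
                * (w (i, inord j.+1) - w (i, inord j))
   + \sum_x ex i x
   + (rhoL i - n e (i, ord0)) * w (i, ord0)
   + (rhoR i - n e (i, ord_max)) * w (i, ord_max))).
  apply: eq_bigr => i _; rewrite !big_split/=; congr (_ + _ + _ + _).
  - rewrite -(sum_bonds (fun x y => eps ^+ i * (n e (i, x) - n e (i, y))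
                * (w (i, y) - w (i, x)))).
    by apply: eq_bigr => x _; case: ifP => // _; rewrite !jump_cmove; ring.
  - by apply: eq_bigr => x _; rewrite jump_cmove.
  - rewrite (sum_if_val_eq (fun x => _) ord0)//.
    by rewrite jump_cdel weight_cadd; ring.
  - rewrite (sum_if_val_eq (fun x => _) ord_max)//.
    by rewrite jump_cdel weight_cadd; ring.
rewrite !sum_layers.
suff -> : \sum_x ex layer0 x = \sum_x gamma * n e (layer0, x) * (w (flip layer0, x) - w (layer0, x))
  + \sum_x gamma * n e (layer1, x) * (w (flip layer1, x) - w (layer1, x)) - \sum_x ex layer1 x.
  ring.
rewrite -big_split -sumrB; apply: eq_bigr => x _.
rewrite /ex (_ : flip layer0 = layer1)// (_ : flip layer1 = layer0)//=; ring.
Qed.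

(** * Signs and bounds of the rates *)

Hypothesis sigmaP : sigma = -1 \/ sigma = 0 \/ sigma = 1.
Hypotheses (eps_ge0 : 0 <= eps) (gamma_ge0 : 0 <= gamma).
Hypotheses (rhoL_ge0 : forall i, 0 <= rhoL i) (rhoR_ge0 : forall i, 0 <= rhoR i).
Hypothesis rhoL_le1 : sigma = -1 -> forall i, rhoL i <= 1.
Hypothesis rhoR_le1 : sigma = -1 -> forall i, rhoR i <= 1.

Let cmax := 1 + eps + gamma + \sum_i (rhoL i + rhoR i).

(** Retains what the estimates need. For a removal, [1 + r <= cmax] controls the factor
    [1 + sigma * r], and [r <= 1] keeps it nonnegative under exclusion. *)
Inductive transition_spec e : R * config N -> Prop :=
| TransitionMove c a b of 0 <= c <= cmax & a != b :
    transition_spec e (c * n e a * (1 + sigma * n e b), cmove e a b)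
| TransitionDel r a of 0 <= r & 1 + r <= cmax & (sigma = -1 -> r <= 1) :
    transition_spec e (n e a * (1 + sigma * r), cdel e a)
| TransitionAdd r a of 0 <= r & 1 + r <= cmax :
    transition_spec e (r * (1 + sigma * n e a), Defs.cadd e a).

Lemma transitionP e t : t \in tr e -> transition_spec e t.
Proof.
move: (eps_ge0) (gamma_ge0) => e0 g0.
have rho0 : 0 <= \sum_i (rhoL i + rhoR i) by apply: sumr_ge0 => i _; rewrite addr_ge0.
have rho_le i : 1 + rhoL i <= cmax /\ 1 + rhoR i <= cmax.
  rewrite /cmax (bigD1 i)//=.
  have : 0 <= \sum_(j | j != i) (rhoL j + rhoR j) by apply: sumr_ge0 => j _; rewrite addr_ge0.
  by have := rhoL_ge0 i; have := rhoR_ge0 i; move=> *; split; lra.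
have eps_le i : 0 <= eps ^+ (i : 'I_2) <= cmax.
  move: i; apply: layerP; rewrite /= ?expr0 ?expr1 /cmax; apply/andP; split; lra.
have gamma_le : 0 <= gamma <= cmax by rewrite /cmax; apply/andP; split; lra.
move=> /flattenP[/= s /mapP[/= i _ ->]] /flattenP[/= _ /mapP[/= x _ ->]].
rewrite mem_cat in_cons mem_cat => /or4P[].
- case: ifP => // xN; rewrite !inE => /orP[] /eqP ->; apply: TransitionMove => //.
    by rewrite xpair_eqE eqxx -val_eqE val_insubd xN /= neq_ltn ltnSn.
  by rewrite xpair_eqE eqxx -val_eqE val_insubd xN /= neq_ltn ltnSn orbT.
- move=> /eqP ->; apply: TransitionMove => //.
  by rewrite xpair_eqE eqxx andbT; move: i; apply: layerP.
- case: ifP => // _; rewrite !inE => /orP[] /eqP ->.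
    by apply: TransitionDel => //; [have [] := rho_le i|move/rhoL_le1].
  by apply: TransitionAdd => //; have [] := rho_le i.
- case: ifP => // _; rewrite !inE => /orP[] /eqP ->.
    by apply: TransitionDel => //; [have [] := rho_le i|move/rhoR_le1].
  by apply: TransitionAdd => //; have [] := rho_le i.
Qed.

Lemma exclusion_ge0 x : 0 <= x -> (sigma = -1 -> x <= 1) -> 0 <= 1 + sigma * x <= 1 + x.
Proof.
by move=> x0 x1; case: sigmaP x1 => [|[|]] -> => [/(_ erefl)|_|_] *; apply/andP; split; lra.
Qed.

Lemma allowed_le1 e k : allowed sigma e -> sigma = -1 -> n e k <= 1.
Proof. by move=> oke s; rewrite lern1 oke. Qed.

Lemma transition_ge0 e t : allowed sigma e -> t \in tr e -> 0 <= t.1.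
Proof.
move=> oke /transitionP[c a b /andP[c0 _] _|r a r0 _ r1|r a r0 _] /=.
- by have /andP[H _] := exclusion_ge0 _ (ler0n R (e b)) (allowed_le1 _ b oke); rewrite !mulr_ge0.
- by have /andP[H _] := exclusion_ge0 _ r0 r1; rewrite mulr_ge0.
- by have /andP[H _] := exclusion_ge0 _ (ler0n R (e a)) (allowed_le1 _ a oke); rewrite mulr_ge0.
Qed.

(** For [sigma = -1], a nonzero factor [1 - n e b] forces the receiving position to be empty. *)
Lemma transition_allowed e t : allowed sigma e -> t \in tr e -> t.1 != 0 -> allowed sigma t.2.
Proof.
have empty k : allowed sigma e -> sigma = -1 -> 1 + sigma * n e k != 0 -> e k = 0%N.
  move=> oke s; rewrite s mulN1r; have := oke s k.
  by case: (e k) => [|[|//]] // _; rewrite subrr eqxx.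
move=> oke /transitionP[c a b _ ab|r a _ _ _|r a _ _] /=.
- rewrite mulf_eq0 negb_or => /andP[_ nb] s k; rewrite /cmove /cupd !ffunE.
  have := oke s k; have eb := empty _ oke s nb.
  by case: (eqVneq k b) => [->|_]; rewrite ?eb; case: eqP => // _; case: (e k) => [|[]].
- by move=> _ s k; rewrite ffunE; case: ifP => _; have := oke s k; case: (e k) => [|[]].
- rewrite mulf_eq0 negb_or => /andP[_ nb] s k; rewrite ffunE.
  by case: eqP => [->|_]; rewrite ?(empty _ oke s nb)// oke.
Qed.

Lemma occupation_le_weight e k : n e k <= weight (fun=> 1) e.
Proof.
rewrite /weight (bigD1 k)//= mul1r.
have : 0 <= \sum_(j | j != k) 1 * n e j by apply: sumr_ge0 => j _; rewrite mul1r.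
lra.
Qed.

Lemma weight1_ge1 e : 1 <= weight (fun=> 1) e.
Proof. by rewrite lerDl; apply: sumr_ge0 => j _; rewrite mul1r. Qed.

(** Occupation numbers and the factors [1 + sigma * n] are at most the weight; a move multiplies one
    of each, hence the square. *)
Lemma transition_rate_le e t : allowed sigma e -> t \in tr e ->
  t.1 <= cmax * weight (fun=> 1) e ^+ 2.
Proof.
have G1 := weight1_ge1 e.
have nG k : 1 + n e k <= weight (fun=> 1) e.
  rewrite /weight (bigD1 k)//= mul1r lerD2l lerDl.
  by apply: sumr_ge0 => j _; rewrite mul1r.
have occ k : allowed sigma e -> 0 <= 1 + sigma * n e k <= weight (fun=> 1) e.
  move=> oke; have /andP[-> H] := exclusion_ge0 _ (ler0n R (e k)) (allowed_le1 _ k oke).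
  exact: le_trans H (nG k).
have GG : weight (fun=> 1) e <= weight (fun=> 1) e ^+ 2 by rewrite expr2 ler_peMr//; lra.
move=> oke /transitionP[c a b /andP[c0 cM] _|r a r0 rM r1|r a r0 rM] /=.
- have /andP[b0 bG] := occ b oke; have aG := occupation_le_weight e a.
  by rewrite expr2 mulrA ler_pM ?mulr_ge0// ler_pM.
- have /andP[H0 H1] := exclusion_ge0 _ r0 r1.
  rewrite mulrC ler_pM//; first exact: le_trans rM.
  exact: le_trans (occupation_le_weight e a) GG.
- have /andP[b0 bG] := occ a oke.
  rewrite ler_pM//; first lra.
  exact: le_trans GG.
Qed.

(** All configurations have the same number of transitions, so the empty one provides the
    constant. *)
Lemma total_rate_le e : allowed sigma e ->
  \sum_(t <- tr e) t.1 <= (size (tr [ffun=> 0%N]))%:R * cmax * weight (fun=> 1) e ^+ 2.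
Proof.
move=> oke; rewrite (size_transitions _ e) -mulrA -sum1_size natr_sum mulr_suml.
rewrite big_seq [leRHS]big_seq; apply: ler_sum => t te.
by rewrite mul1r transition_rate_le.
Qed.

Lemma jump_le w e t : (forall k, 0 <= w k) -> t \in tr e -> t.1 != 0 ->
  `|weight w t.2 - weight w e| <= \sum_k w k.
Proof.
move=> w0.
have wk k : w k <= \sum_k w k.
  by rewrite (bigD1 k)//= lerDl; apply: sumr_ge0.
move=> /transitionP[c a b _ ab|r a _ _ _|r a _ _] /=.
- rewrite !mulf_eq0 !negb_or -andbA pnatr_eq0 -lt0n => /and3P[_ ea _].
  rewrite weight_cmove// addrC addKr ler_norml.
  by have := w0 a; have := w0 b; have := wk a; have := wk b; move=> *; apply/andP; split; lra.
- rewrite mulf_eq0 negb_or pnatr_eq0 -lt0n => /andP[ea _].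
  by rewrite weight_cdel// addrC addKr normrN ger0_norm.
- by move=> _; rewrite weight_cadd addrC addKr ger0_norm.
Qed.

Lemma affine_linear_generator w : affine (linear_generator w).
Proof.
apply: affine_sum => i; apply: affineD; [apply: affineD; [apply: affineD|]|].
- apply: affine_sum => j; apply/affineZr/affineZ/affineB; exact: affine_coord.
- apply: affine_sum => x; apply/affineZr/affineZ; exact: affine_coord.
- apply/affineZr/affineB; [exact: affine_cst|exact: affine_coord].
- apply/affineZr/affineB; [exact: affine_cst|exact: affine_coord].
Qed.

Lemma linear_generatorD w w' v :
  linear_generator (fun k => w k + w' k) v = linear_generator w v + linear_generator w' v.
Proof.
rewrite -big_split; apply: eq_bigr => i _ /=.
have E (T : finType) (a b c : T -> R) : (forall x, c x = a x + b x) ->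
    \sum_x c x = \sum_x a x + \sum_x b x.
  by move=> H; rewrite -big_split; apply: eq_bigr => x _; rewrite H.
rewrite (E _ (fun j : 'I_M => eps ^+ i * (v (i, inord j) - v (i, inord j.+1))
                * (w (i, inord j.+1) - w (i, inord j)))
  (fun j : 'I_M => eps ^+ i * (v (i, inord j) - v (i, inord j.+1))
                * (w' (i, inord j.+1) - w' (i, inord j)))); last by move=> j; ring.
rewrite (E _ (fun x => gamma * v (i, x) * (w (flip i, x) - w (i, x)))
  (fun x => gamma * v (i, x) * (w' (flip i, x) - w' (i, x)))); last by move=> j; ring.
ring.
Qed.

(** * Finite mean and stationarity of linear observables *)

Variable mu : config N -> R.
Hypothesis stat : is_stationary sigma eps gamma rhoL rhoR mu.

(** This is [wsum_drift] with [h] the number of particles; [w >= 1] makes [weight w] dominate one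
    plus that number. *)
Lemma total_occupation_le w (C : R) : (forall k, 1 <= w k) -> 0 <= C ->
    (forall v, (forall k, 0 <= v k) -> linear_generator w v <= C - \sum_k v k) ->
  (wsum mu (fun e => \sum_k n e k)%R <= C%:E)%E.
Proof.
move=> w1 C0 drift; have [mu_ge0 mu_ok mu1 bal] := stat.
have w0 k : 0 <= w k by exact: le_trans (w1 k).
have G_le_f e : weight (fun=> 1) e <= weight w e.
  by rewrite lerD2l; apply: ler_sum => k _; rewrite ler_wpM2r.
apply: (@wsum_drift _ _ tr (allowed sigma) mu transition_ge0 transition_allowed mu_ge0 mu_ok
  mu1 bal (weight w) (weight (fun=> 1)) _ weight1_ge1 G_le_f total_rate_le) => //.
- by move=> e _; apply: sumr_ge0.
- by move=> e _; rewrite generator_weight; apply: drift.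
Qed.

Lemma linear_generator_theta :
  (wsum mu (fun e => \sum_k n e k)%R < +oo)%E ->
  exists2 th : 'I_2 * 'I_N -> R, (forall i x, theta mu i x = (th (i, x))%:E) &
    forall w, linear_generator w th = 0.
Proof.
move=> fin; have [mu_ge0 mu_ok mu1 bal] := stat.
have muM g : (forall e, 0 <= g e) -> forall e, 0 <= mu e * g e by move=> g0 e; rewrite mulr_ge0.
have occ0 e : 0 <= \sum_k n e k by apply: sumr_ge0.
have [s s0 sE] : exists2 s, 0 <= s & wsum mu (fun e => \sum_k n e k) = s%:E.
  have := wsum_ge0 _ _ (muM _ occ0); move: fin; case: (wsum _ _) => //= r.
  by rewrite lee_fin => _ r0; exists r.
have /fin_all_exists2[th th0 thE] k : exists2 x, 0 <= x & wsum mu (fun e => n e k) = x%:E.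
  apply: (@wsum_fin _ _ _ _ s); first exact: muM.
  rewrite -sE; apply: le_wsum => e; rewrite ler_wpM2l// (bigD1 k)//= lerDl.
  exact: sumr_ge0.
exists th; first by move=> i x; exact: thE.
have wsumC c : 0 <= c -> wsum mu (fun=> c) = c%:E by exact: wsum_cst.
have Gfin : (wsum mu (weight (fun=> 1%R)) < +oo)%E.
  rewrite [X in wsum mu X](_ : _ = fun e => 1 + \sum_k n e k); last first.
    by apply/funext => e; rewrite /weight; congr (_ + _); apply: eq_bigr => k _; rewrite mul1r.
  by rewrite wsumD; [rewrite wsumC// sE ltry|exact: muM|exact: muM].
have wsum_affine c (a : 'I_2 * 'I_N -> R) : 0 <= c -> (forall k, 0 <= a k) ->
    wsum mu (fun e => c + \sum_k a k * n e k) = (c + \sum_k a k * th k)%:E.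
  move=> c0 a0; rewrite wsumD; first last.
  - by apply: muM => e; apply: sumr_ge0 => k _; rewrite mulr_ge0.
  - exact: muM.
  rewrite wsumC// wsum_sum; last by move=> k; apply: muM => e; rewrite mulr_ge0.
  rewrite EFinD -sumEFin; congr (_ + _)%E; apply: eq_bigr => k _.
  by rewrite wsumZ// thE.
have pos w : (forall k, 1 <= w k) -> linear_generator w th = 0.
  move=> w1; have w0 k : 0 <= w k by exact: le_trans (w1 k).
  have G_le_f e : weight (fun=> 1) e <= weight w e.
    by rewrite lerD2l; apply: ler_sum => k _; rewrite ler_wpM2r.
  have f_le e : weight w e <= (1 + \sum_k w k) * weight (fun=> 1) e.
    have W1 : 1 <= 1 + \sum_k w k by rewrite lerDl sumr_ge0.
    rewrite {2}/weight mulrDr mulr1 lerD// mulr_sumr; apply: ler_sum => k _.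
    rewrite mul1r ler_wpM2r// (bigD1 k)//= addrCA lerDl.
    by rewrite addr_ge0// sumr_ge0.
  have [c [a LE]] := affine_linear_generator w.
  pose pp (x : R) := Num.max 0 x.
  have pp0 x : 0 <= pp x by rewrite le_max lexx.
  have ppB x : pp x - pp (- x) = x.
    by rewrite /pp; case: (leP 0 x) => x0; case: (leP 0 (- x)) => x1; lra.
  have ppN x : pp x <= `|x| by rewrite ge_max normr_ge0 ler_norm.
  have ppN' x : pp (- x) <= `|x| by rewrite -normrN ppN.
  (* [A - B] is the generator of [weight w], split by the signs of its coefficients because means
     are added only for nonnegative terms. *)
  pose A e := pp c + \sum_k pp (a k) * n e k.
  pose B e := pp (- c) + \sum_k pp (- a k) * n e k.
  pose K' := `|c| + \sum_k `|a k|.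
  have K'0 : 0 <= K' by rewrite addr_ge0// sumr_ge0.
  have bound (c' : R) (a' : 'I_2 * 'I_N -> R) e : 0 <= c' <= `|c| ->
      (forall k, 0 <= a' k <= `|a k|) ->
      0 <= c' + \sum_k a' k * n e k <= K' * weight (fun=> 1) e.
    move=> /andP[c0 cc] ha; apply/andP; split.
      by rewrite addr_ge0// sumr_ge0// => k _; have /andP[a0 _] := ha k; rewrite mulr_ge0.
    rewrite mulrDl lerD//.
      by apply: (le_trans cc); rewrite ler_peMr// weight1_ge1.
    rewrite mulr_suml; apply: ler_sum => k _; have /andP[a0 aa] := ha k.
    by rewrite ler_pM// occupation_le_weight.
  have AB : wsum mu A = wsum mu B.
    apply: (@wsum_generator _ _ tr (allowed sigma) mu transition_ge0 transition_allowed mu_ge0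
      mu_ok mu1 bal (weight w) (weight (fun=> 1)) (1 + \sum_k w k) (\sum_k w k) _ weight1_ge1
      G_le_f f_le (fun e t _ => jump_le w e t w0) total_rate_le A B K' K'0) => //.
    - exact: sumr_ge0.
    - by move=> e _; apply: bound => [|k]; rewrite pp0 ppN.
    - by move=> e _; apply: bound => [|k]; rewrite pp0 ppN'.
    - move=> e _; rewrite generator_weight LE /A /B opprD addrACA ppB; congr (_ + _).
      by rewrite -sumrB; apply: eq_bigr => k _; rewrite -mulrBl ppB.
  move: AB; rewrite !wsum_affine// => -[AB].
  rewrite LE -[c]ppB; under eq_bigr do rewrite -[a _]ppB mulrBl.
  by rewrite sumrB addrACA -opprD AB subrr.
(* Any [w] is the difference of [w + C] and the constant [C], both at least 1, and the generator is
   additive in the weight. *)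
move=> w; pose C := 1 + \sum_k `|w k|.
have C1 : 1 <= C by rewrite lerDl sumr_ge0.
have := linear_generatorD w (fun=> C) th.
rewrite (pos (fun=> C))// addr0 pos// => k.
have : `|w k| <= \sum_k `|w k| by rewrite (bigD1 k)//= lerDl sumr_ge0.
by have := ler_norm (- w k); rewrite normrN /C; lra.
Qed.

End Switching.

(** * The profile when the particles of layer 1 do not move *)

Section LayerOneImmobile.
Context {R : realType} {M : nat}.
Variables (gamma : R) (rhoL rhoR : 'I_2 -> R).
Let N := M.+1.
Implicit Types (w v : 'I_2 * 'I_N -> R).

Local Notation LG := (@linear_generator R M 0 gamma rhoL rhoR).

(** The factor [eps ^+ i] is [0 ^+ 0 = 1] in layer 0 and 0 in layer 1, so only the bonds of layer 0
    survive. *)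
Lemma linear_generator_eps0 w v : LG w v =
  \sum_(j < M) (v (layer0, inord j) - v (layer0, inord j.+1))
     * (w (layer0, inord j.+1) - w (layer0, inord j))
  + \sum_x gamma * (v (layer0, x) - v (layer1, x)) * (w (layer1, x) - w (layer0, x))
  + \sum_i (rhoL i - v (i, ord0)) * w (i, ord0)
  + \sum_i (rhoR i - v (i, ord_max)) * w (i, ord_max).
Proof.
rewrite /linear_generator !sum_layers /=.
under eq_bigr do rewrite expr0 mul1r.
rewrite [X in _ + _ + _ + _ + (X + _ + _ + _)]big1 ?add0r; last first.
  by move=> j _; rewrite expr1 !mul0r.
have -> : \sum_x gamma * (v (layer0, x) - v (layer1, x)) * (w (layer1, x) - w (layer0, x)) =
  \sum_x gamma * v (layer0, x) * (w (flip layer0, x) - w (layer0, x)) +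
  \sum_x gamma * v (layer1, x) * (w (flip layer1, x) - w (layer1, x)).
  rewrite -big_split; apply: eq_bigr => x _ /=.
  by rewrite (_ : flip layer0 = layer1)// (_ : flip layer1 = layer0)//; ring.
ring.
Qed.

(** Summation by parts; for [c = N] the factors are the increments of [y * (N + 1 - y)] from
    [y = j + 1] to [j + 2]. *)
Lemma sum_bond_quadratic (u : nat -> R) (c : R) (m : nat) :
  \sum_(j < m) (u j - u j.+1) * (c - 2 * j.+1%:R) =
  c * u 0%N - 2 * \sum_(j < m.+1) u j - (c - 2 * m.+1%:R) * u m.
Proof.
elim: m => [|m IH]; first by rewrite big_ord0 big_ord1; ring.
rewrite big_ord_recr IH [in RHS]big_ord_recr /= -!natr1; ring.
Qed.

(* On this weight the one-particle generator is [-1] in layer 0 (second difference [-2] of the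
   quadratic part, plus [1] from switching) and at most [-1] in layer 1. *)
Definition absorption_weight (k : 'I_2 * 'I_N) : R :=
  k.2.+1%:R * (N%:R + 1 - k.2.+1%:R) + (if k.1 == layer0 then 0 else gamma^-1).

Lemma absorption_weight_ge1 k : 0 < gamma -> 1 <= absorption_weight k.
Proof.
move=> g0; apply: (@le_trans _ _ (k.2.+1%:R * (N%:R + 1 - k.2.+1%:R))).
  have : k.2.+1%:R <= N%:R :> R by rewrite ler_nat ltn_ord.
  have : 1 <= k.2.+1%:R :> R by rewrite ler1n.
  by nra.
by rewrite lerDl; case: ifP => // _; rewrite invr_ge0 ltW.
Qed.

(** In layer 0 the weight equals [N] at both ends, so absorption there cancels the boundary terms of
    the summation by parts exactly. *)
Lemma absorption_drift v : 0 < gamma -> (forall k, 0 <= v k) ->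
  LG absorption_weight v <=
  \sum_i (rhoL i * absorption_weight (i, ord0) + rhoR i * absorption_weight (i, ord_max))
  - \sum_k v k.
Proof.
move=> g0 v0; rewrite linear_generator_eps0.
have -> : \sum_k v k = \sum_x v (layer0, x) + \sum_x v (layer1, x).
  by rewrite -(sum_layers (fun i => \sum_x v (i, x))) pair_big; apply: eq_bigr => -[].
have -> : \sum_x gamma * (v (layer0, x) - v (layer1, x)) *
    (absorption_weight (layer1, x) - absorption_weight (layer0, x)) =
    \sum_x v (layer0, x) - \sum_x v (layer1, x).
  rewrite -sumrB; apply: eq_bigr => x _.
  by rewrite /absorption_weight /=; field; rewrite gt_eqF.
pose u j := v (layer0, inord j : 'I_N).
have -> : \sum_(j < M) (v (layer0, inord j) - v (layer0, inord j.+1)) *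
     (absorption_weight (layer0, inord j.+1) - absorption_weight (layer0, inord j)) =
   \sum_(j < M) (u j - u j.+1) * (N%:R - 2 * j.+1%:R).
  apply: eq_bigr => j _; congr (_ * _); rewrite /absorption_weight /=.
  rewrite !inordK ?ltnS//; last exact: ltnW.
  by rewrite -[j.+2%:R]natr1; ring.
rewrite sum_bond_quadratic.
have -> : \sum_(j < M.+1) u j = \sum_x v (layer0, x).
  by apply: eq_bigr => j _; rewrite /u inord_val.
have -> : u 0%N = v (layer0, ord0) by congr (v (_, _)); apply: val_inj; rewrite /= inordK.
have -> : u M = v (layer0, ord_max) by congr (v (_, _)); apply: val_inj; rewrite /= inordK.
rewrite !sum_layers /absorption_weight /= !addr0.
have gi : 0 <= gamma^-1 by rewrite invr_ge0 ltW.
have NE : N%:R = M%:R + 1 :> R by rewrite natr1.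
have M0 : 0 <= M%:R :> R by [].
rewrite -/N NE.
(* Absorption at the ends of layer 1 only lowers the generator and is dropped. *)
have p1 : 0 <= v (layer1, ord0) * (1 * (M%:R + 1 + 1 - 1) + gamma^-1).
  by rewrite mulr_ge0//; lra.
have p2 : 0 <= v (layer1, ord_max) * ((M%:R + 1) * (M%:R + 1 + 1 - (M%:R + 1)) + gamma^-1).
  by rewrite mulr_ge0// addr_ge0// mulr_ge0//; lra.
set s0 := \sum_x v (layer0, x); set s1 := \sum_x v (layer1, x).
lra.
Qed.

(* Test function [1_{x <= m}] on both layers: since layer 1 does not move, it isolates the
   current through the bond of layer 0 to the right of [m]. *)
Lemma bond_current v (m : nat) : (forall w, LG w v = 0) -> (m < M)%N ->
  v (layer0, inord m) - v (layer0, inord m.+1) = \sum_i (rhoL i - v (i, ord0)).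
Proof.
move=> H mM; have := H (fun k => (k.2 <= m)%N%:R); rewrite linear_generator_eps0 /=.
(* The test function changes, by -1, only across the bond from [m] to [m + 1]. *)
rewrite (bigD1 (Ordinal mM))//= big1 => [|j jm]; last first.
  rewrite !inordK ?ltnS// ?[(j <= M)%N]ltnW// [(j <= m)%N]leq_eqVlt.
  by move: jm; rewrite -val_eqE /= => /negPf ->; rewrite subrr mulr0.
rewrite !inordK ?ltnS// ?[(m <= M)%N]ltnW// ltnn leqnn.
rewrite [X in _ + X + _ + _]big1 => [|x _]; last by rewrite subrr mulr0.
rewrite [in X in _ + X = 0]leqNgt mM !sum_layers /=; lra.
Qed.

Lemma total_balance v : (forall w, LG w v = 0) ->
  \sum_i (rhoL i - v (i, ord0)) + \sum_i (rhoR i - v (i, ord_max)) = 0.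
Proof.
move=> H; have := H (fun=> 1); rewrite linear_generator_eps0.
rewrite big1 => [|j _]; last by rewrite subrr mulr0.
rewrite big1 => [|j _]; last by rewrite subrr mulr0.
by rewrite !add0r -!mulr_suml !mulr1.
Qed.

(** The indicator of one site of layer 1 sees only the switching at that site and, at the ends, the
    reservoir. *)
Lemma switching_balance v (x : 'I_N) : (forall w, LG w v = 0) ->
  gamma * (v (layer0, x) - v (layer1, x))
  + (if x == ord0 then rhoL layer1 - v (layer1, ord0) else 0)
  + (if x == ord_max then rhoR layer1 - v (layer1, ord_max) else 0) = 0.
Proof.
move=> H; have := H (fun k => (k == (layer1, x))%:R); rewrite linear_generator_eps0.
rewrite big1 => [|j _]; last by rewrite !xpair_eqE subrr mulr0.
rewrite (bigD1 x)//= big1 => [|y /negPf yx]; last first.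
  by rewrite !xpair_eqE yx !andbF subrr mulr0.
rewrite !sum_layers !xpair_eqE /= !eqxx ![x == _]eq_sym => E.
rewrite -[RHS]E {E}.
by case: (ord0 == x); case: (ord_max == x) => /=; ring.
Qed.

End LayerOneImmobile.

(** Here [t] and [t - m * J] are the densities of layer 0 at the two ends, [vL] and [vR] those of
    layer 1, [J] is the current, and the index [x] stands for site [x + 1]. *)
Lemma profile_solution (R : realFieldType) (gamma rL0 rL1 rR0 rR1 t J vL vR m x : R) :
  0 < gamma -> 0 <= m ->
  gamma * (t - vL) + (rL1 - vL) = 0 ->
  gamma * (t - m * J - vR) + (rR1 - vR) = 0 ->
  J = rL0 - t + (rL1 - vL) ->
  J + (rR0 - (t - m * J) + (rR1 - vR)) = 0 ->
  let N := m + 1 in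
  let D := 1 + N + 2 * N * gamma in
  let a := ((1 + N) + (1 + 2 * N) * gamma) / D - (1 + 2 * gamma) / D * (x + 1) in
  let b := - gamma / D + (1 + 2 * gamma) / D * (x + 1) in
  t - x * J = (1 + gamma) / (1 + 2 * gamma) * (a * rL0 + b * rR0)
              + gamma / (1 + 2 * gamma) * (a * rL1 + b * rR1).
Proof.
move=> g0 m0 eL eR eJ eT N D a b.
have D0 : D != 0.
  have mg : 0 <= m * gamma by rewrite mulr_ge0// ltW.
  by rewrite gt_eqF// /D /N; lra.
have g1 : 1 + gamma != 0 by rewrite gt_eqF//; lra.
have g2 : 1 + 2 * gamma != 0 by rewrite gt_eqF//; lra.
(* Effective reservoir strengths, left over once [vL] and [vR] are eliminated. *)
pose PL := (1 + gamma) * rL0 + gamma * rL1; pose PR := (1 + gamma) * rR0 + gamma * rR1.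
have vLE : vL = (gamma * t + rL1) / (1 + gamma) by apply: (mulIf g1); rewrite mulfVK//; lra.
have vRE : vR = (gamma * (t - m * J) + rR1) / (1 + gamma).
  by apply: (mulIf g1); rewrite mulfVK//; lra.
have eqL : (1 + gamma) * J = PL - (1 + 2 * gamma) * t.
  by rewrite eJ vLE /PL; field.
have eqR : (1 + gamma) * J = (1 + 2 * gamma) * (t - m * J) - PR.
  have -> : (1 + gamma) * J = - ((1 + gamma) * (rR0 - (t - m * J) + (rR1 - vR))).
    by rewrite -mulrN; congr (_ * _); lra.
  by rewrite vRE /PR; field.
(* Adding [eqL] and [eqR] eliminates [t] and gives [D * J = PL - PR]. *)
have JE : J = (PL - PR) / D.
  by apply: (mulIf D0); rewrite mulfVK// /D /N; lra.
have tE : t = (PL - (1 + gamma) * J) / (1 + 2 * gamma).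
  by apply: (mulIf g2); rewrite mulfVK//; lra.
rewrite tE JE /a /b /PL /PR; move: D0; rewrite /D /N => D0; field.
by apply/andP; split.
Qed.

Theorem mainTheorem5 (R : realType) (sigma gamma rL0 rL1 rR0 rR1 : R) (N : nat)
    (mu : config N -> R) :
  (sigma = -1 \/ sigma = 0 \/ sigma = 1) ->
  0 < gamma -> (2 <= N)%N ->
  0 <= rL0 -> 0 <= rL1 -> 0 <= rR0 -> 0 <= rR1 ->
  (sigma = -1 -> [/\ rL0 <= 1, rL1 <= 1, rR0 <= 1 & rR1 <= 1]) ->
  is_stationary sigma 0 gamma
    (fun i : 'I_2 => if i == layer0 then rL0 else rL1)
    (fun i : 'I_2 => if i == layer0 then rR0 else rR1) mu ->
  forall x : 'I_N,
    let xs : R := (x.+1)%:R in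
    let D : R := 1 + N%:R + 2 * N%:R * gamma in
    let a : R := ((1 + N%:R) + (1 + 2 * N%:R) * gamma) / D - (1 + 2 * gamma) / D * xs in
    let b : R := - gamma / D + (1 + 2 * gamma) / D * xs in
    let th0 : R := (1 + gamma) / (1 + 2 * gamma) * (a * rL0 + b * rR0)
                   + gamma / (1 + 2 * gamma) * (a * rL1 + b * rR1) in
    theta mu layer0 x = th0%:E /\
    theta mu layer1 x =
      (if val x == 0%N then gamma / (1 + gamma) * th0 + 1 / (1 + gamma) * rL1
       else if val x == N.-1 then gamma / (1 + gamma) * th0 + 1 / (1 + gamma) * rR1
       else th0)%:E.
Proof.
move=> sigmaP g0; case: N mu => [//|M] mu M1 rL0_ge rL1_ge rR0_ge rR1_ge rho1.
set rhoL := fun i : 'I_2 => _; set rhoR := fun i : 'I_2 => _ => stat x xs D a b th0.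
have rhoL0 i : 0 <= rhoL i by rewrite /rhoL; case: ifP.
have rhoR0 i : 0 <= rhoR i by rewrite /rhoR; case: ifP.
have rhoL1 : sigma = -1 -> forall i, rhoL i <= 1.
  by move=> /rho1[? ? ? ?] i; rewrite /rhoL; case: ifP.
have rhoR1 : sigma = -1 -> forall i, rhoR i <= 1.
  by move=> /rho1[? ? ? ?] i; rewrite /rhoR; case: ifP.
have w0 k : 0 <= @absorption_weight R M gamma k.
  exact: le_trans (absorption_weight_ge1 _ _ g0).
have finite_mean := total_occupation_le _ _ _ _ _ sigmaP (lexx 0) (ltW g0) rhoL0 rhoR0 rhoL1
  rhoR1 _ stat _ _ (absorption_weight_ge1 gamma ^~ g0) _ (absorption_drift _ rhoL rhoR ^~ g0).
have [|th thE H] := linear_generator_theta _ _ _ _ _ sigmaP (lexx 0) (ltW g0) rhoL0 rhoR0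
  rhoL1 rhoR1 _ stat.
  apply: le_lt_trans (finite_mean _) (ltry _).
  by apply: sumr_ge0 => i _; rewrite addr_ge0// mulr_ge0.
rewrite !thE.
pose t := th (layer0, ord0); pose J := \sum_i (rhoL i - th (i, ord0)).
(* The current is the same through every bond, so the profile of layer 0 is affine. *)
have linear m : (m <= M)%N -> th (layer0, inord m) = t - m%:R * J.
  elim: m => [_|m IH mM].
    by rewrite mul0r subr0; congr (th (_, _)); apply: val_inj; rewrite /= inordK.
  have := bond_current _ _ _ _ _ H mM; rewrite IH ?(ltnW mM)// -natr1 -/J; lra.
have linear_x y : th (layer0, y) = t - y%:R * J.
  by rewrite -linear ?inord_val// -ltnS.
(* As [N >= 2], the ends are distinct sites and each of these balances involves one reservoir. *)
have := switching_balance _ _ _ _ ord0 H; rewrite eqxx -val_eqE /= ltn_eqF// addr0.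
have := switching_balance _ _ _ _ ord_max H; rewrite eqxx -val_eqE /= gtn_eqF// addr0.
have := total_balance _ _ _ _ H; rewrite -/J.
have : J = rhoL layer0 - t + (rhoL layer1 - th (layer1, ord0)) by rewrite /J sum_layers.
rewrite sum_layers linear_x /rhoL /rhoR /= -/t => eJ eT eR eL.
have g1 : 1 + gamma != 0 by rewrite gt_eqF//; lra.
have th0E : th (layer0, x) = th0.
  rewrite linear_x /th0 /a /b /D /xs -[M.+1%:R]natr1 -[x.+1%:R]natr1.
  exact: profile_solution g0 (ler0n R M) eL eR eJ eT.
split; first by rewrite th0E.
congr (_%:E); have := switching_balance _ _ _ _ x H; rewrite th0E -!val_eqE /=.
case: eqP => x0 /=.
  have -> : (x == M :> nat) = false by rewrite x0 ltn_eqF.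
  have -> : x = ord0 by exact: val_inj.
  rewrite /rhoL /= => E.
  have F : (1 + gamma) * th (layer1, ord0) = gamma * th0 + rL1 by lra.
  by apply: (mulfI g1); rewrite F; field.
(* At an interior site the balance reduces to [gamma * (th0 - th (layer1, x)) = 0]. *)
case: eqP => xM /= E; last by apply: (mulfI (lt0r_neq0 g0)); lra.
have xE : x = ord_max by exact: val_inj.
move: E; rewrite xE /rhoR /= => E.
have F : (1 + gamma) * th (layer1, ord_max) = gamma * th0 + rR1 by lra.
by apply: (mulfI g1); rewrite F; field.
Qed.
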